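(* There exists a computable topological space $(S,\tau,\beta,\nu)$ such that $(S,\tau)$ is a compact Polish space and $(S,\tau)$ is not homeomorphic to any computably metrized Polish space.
   Context: A computable topological space is a tuple $(X,\tau,\beta,\nu)$ where $(X,\tau)$ is a $T_0$ topological space, $\beta$ is a base of $\tau$, $\nu\colon\omega\to\beta$ is surjective, and there is a c.e. set $W$ such that for all $i,j\in\omega$, $\nu(i)\cap\nu(j)=\bigcup\{\nu(k): (i,j,k)\in W\}$. A Polish space $M$ is computably metrized (computably metrizable) if there is a compatible complete metric $d$ on $M$ and a dense sequence $(\alpha_i)_{i\in\omega}$ of points of $M$ (repetitions allowed) such that the reals $d(\alpha_i,\alpha_j)$ are computable uniformly in $i,j$. Here ''not homeomorphic to any computably metrized Polish space'' means there is no homeomorphism (computable or not) between $S$ and such a space. *)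

(* Defs.v *)
From mathcomp Require Import all_boot all_order all_algebra.
From mathcomp Require Import all_classical all_reals all_analysis.

Set Implicit Arguments.
Unset Strict Implicit.
Unset Printing Implicit Defensive.

Import Order.TTheory GRing.Theory Num.Theory.
Import numFieldNormedType.Exports.

Local Open Scope classical_set_scope.
Local Open Scope ring_scope.

(* Kleene's description of the partial computable functions from nat^k to nat:
   [mu_rec k] is the type of programs and [computes f v y] means that f halts on
   v with value y. *)
Inductive mu_rec : nat -> Type :=
| Zero k : mu_rec k
| Succ : mu_rec 1
| Proj k (i : 'I_k) : mu_rec k
| Comp k m (f : mu_rec m) (g : 'I_m -> mu_rec k) : mu_rec k
| PrimRec k (f : mu_rec k) (g : mu_rec k.+2) : mu_rec k.+1
| Mu k (f : mu_rec k.+1) : mu_rec k.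

Fixpoint computes k (f : mu_rec k) : k.-tuple nat -> nat -> Prop :=
  match f in mu_rec k return k.-tuple nat -> nat -> Prop with
  | Zero _ => fun _ y => y = 0%N
  | Succ => fun v y => y = (thead v).+1
  | Proj _ i => fun v y => y = tnth v i
  | Comp k m f g => fun v y =>
      exists2 w : m.-tuple nat,
        forall i, computes (g i) v (tnth w i) & computes f w y
  | PrimRec k f g => fun v y =>
      (* s lists the values at 0, 1, ..., thead v; behead v is the parameter *)
      exists s : nat -> nat,
        [/\ computes f [tuple of behead v] (s 0%N),
            forall i, (i < thead v)%N ->
              computes g [tuple of i :: s i :: behead v] (s i.+1)
          & y = s (thead v)]
  | Mu k f => fun v y =>
      computes f [tuple of y :: v] 0%N /\
      forall i, (i < y)%N -> exists z, computes f [tuple of i :: v] z.+1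
  end.

Definition computable_fun k (f : k.-tuple nat -> nat) :=
  exists c : mu_rec k, forall v, computes c v (f v).

Definition ce_set k (W : set (k.-tuple nat)) :=
  exists c : mu_rec k, W = [set v | exists y, computes c v y].

(* The reals x v are computable uniformly in v: from n and v one computes a
   rational (a - b) / (c + 1) at distance at most 2^-n from x v. *)
Definition uniformly_computable (R : realType) k (x : k.-tuple nat -> R) :=
  exists a b c : k.+1.-tuple nat -> nat,
    [/\ computable_fun a, computable_fun b, computable_fun c &
        forall (v : k.-tuple nat) (n : nat),
          let w := [tuple of n :: v] in
          `|x v - ((a w)%:R - (b w)%:R) / (c w).+1%:R| <= 2 ^- n].

(* (T, beta, nu) is a computable topological space; the topology is that of T,
   and range nu = beta says that nu is a surjection from nat onto beta. *)
Definition computable_topological_space (T : topologicalType)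
    (beta : set (set T)) (nu : nat -> set T) :=
  [/\ kolmogorov_space T, basis beta, range nu = beta &
      exists2 W : set (3.-tuple nat), ce_set W &
        forall i j,
          nu i `&` nu j = \bigcup_(k in [set k | W [tuple i; j; k]]) nu k].

Record compatible_complete_metric (R : realType) (T : topologicalType)
    (d : T -> T -> R) : Prop := {
  metricxx : forall x, d x x = 0 ;
  metric_positivity : forall x y, d x y = 0 -> x = y ;
  metric_symmetry : forall x y, d x y = d y x ;
  metric_triangular : forall y x z, d x z <= d x y + d y z ;
  metric_compatible :
    forall x, nbhs x = nbhs_ball_ (fun y e => [set z | d y z < e]) x ;
  metric_complete : forall u : nat -> T,
    (forall e, 0 < e ->
       exists N, forall m n, (N <= m)%N -> (N <= n)%N -> d (u m) (u n) < e) ->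
    exists x : T, u @ \oo --> x
}.

(* Since separability is witnessed by a sequence, Polish spaces are nonempty
   here.  The empty space also has no dense sequence of points to make it
   computably metrized, so it must not count as a counterexample. *)
Definition polish (R : realType) (T : topologicalType) :=
  (exists d : T -> T -> R, compatible_complete_metric d) /\
  (exists alpha : nat -> T, dense (range alpha)).

Definition computably_metrized (R : realType) (T : topologicalType) :=
  exists (d : T -> T -> R) (alpha : nat -> T),
    [/\ compatible_complete_metric d, dense (range alpha) &
        uniformly_computable
          (fun v : 2.-tuple nat => d (alpha (tnth v ord0)) (alpha (tnth v ord_max)))].

Definition homeomorphic (S T : topologicalType) :=
  exists (f : S -> T) (g : T -> S),
    [/\ cancel f g, cancel g f, continuous f & continuous g].

(* Main.v *)
(* There are only countably many computable distance matrices, because there are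
   countably many programs, and a complete metric space is determined up to
   isometry by the distance matrix of a dense sequence.  For every computable
   distance matrix realised in a countable compact metric space, choose such a
   space; let S be the one-point compactification of the disjoint union of two
   copies of each chosen space.  S is again countable, compact and metrizable.
   If S were homeomorphic to a computably metrized space M, then M would embed
   isometrically in a chosen space, so S would contain two disjoint copies of
   itself; iterating, S would contain a Cantor scheme of nonempty compact sets
   and be uncountable.

   On the other hand every second countable T0 space is a computable topological
   space: close a countable base formally under finite intersections and index
   these by finite sets, so that the intersection of two basic sets is given by
   the union of their indices. *)
Require Import Defs.
From HB Require Import structures.
From Stdlib Require Import Eqdep_dec.
From mathcomp Require Import all_boot all_order all_algebra.
From mathcomp Require Import all_classical all_reals all_analysis.
From mathcomp Require Import lra.

Set Implicit Arguments.
Unset Strict Implicit.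
Unset Printing Implicit Defensive.

Import Order.TTheory GRing.Theory Num.Theory.
Import numFieldNormedType.Exports.

Local Open Scope classical_set_scope.
Local Open Scope ring_scope.

(** * Computable functions and indexed bases *)

Lemma computes_fun k (f : mu_rec k) v y z :
  computes f v y -> computes f v z -> y = z.
Proof.
elim: f v y z => {k} [k|||k m f IHf g IHg|k f IHf g IHg|k f IHf] v y z /=.
- by move=> -> ->.
- by move=> -> ->.
- by move=> k i -> ->.
- move=> [w gw fw] [w' gw' fw']; suff ww : w = w' by apply: IHf fw _; rewrite ww.
  by apply: eq_from_tnth => i; apply: IHg (gw i) (gw' i).
- move=> [s [s0 sS ->]] [t [t0 tS ->]].
  suff /(_ (thead v) (leqnn _)) : forall i, (i <= thead v)%N -> s i = t i by [].
  elim=> [_|i IHi iv]; first exact: IHf s0 t0.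
  by apply: IHg (sS i iv) _; rewrite (IHi (ltnW iv)); exact: tS.
- move=> [fy Ny] [fz Nz]; case: (ltngtP y z) => // [/Nz|/Ny] [u] fu.
    by have := IHf _ _ _ fy fu.
  by have := IHf _ _ _ fz fu.
Qed.

(** * Countability of programs and of uniformly computable families *)

Lemma existT_mu_rec_inj k (f g : mu_rec k) :
  existT mu_rec k f = existT mu_rec k g -> f = g.
Proof. exact: inj_pair2_eq_dec (@eq_comparable nat) _ _ _ _. Qed.

Section code.
Import GenTree.

(** Trees over [nat] form a countable type. The arities stored in the leaves let a code determine
    the type of its program. *)
Fixpoint mu_rec_code k (f : mu_rec k) : tree nat :=
  match f with
  | Zero k => Node 0 [:: Leaf k]
  | Succ => Node 1 [::]
  | Proj k i => Node 2 [:: Leaf k; Leaf (val i)]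
  | Comp k m f g => Node 3 [:: Leaf k, Leaf m, mu_rec_code f &
      [seq mu_rec_code (g i) | i <- enum 'I_m]]
  | PrimRec k f g => Node 4 [:: Leaf k; mu_rec_code f; mu_rec_code g]
  | Mu k f => Node 5 [:: Leaf k; mu_rec_code f]
  end.

(** The induction needs two unrelated arities: those of subprograms agree only once the leaves have
    been compared. *)
Lemma mu_rec_code_inj_dep k (f : mu_rec k) k' (f' : mu_rec k') :
  mu_rec_code f = mu_rec_code f' -> existT mu_rec k f = existT mu_rec k' f'.
Proof.
elim: f k' f' => {k} [k||k i|k m f IHf g IHg|k f IHf g IHg|k f IHf] k' [] //=.
- by move=> ? [->].
- move=> k2 i2 [kk]; move: i i2; rewrite kk => i i2 ii.
  by congr (existT _ _ (Proj _)); apply: val_inj.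
- move=> k2 m2 f2 g2 [kk mm ff gg]; move: f g IHf IHg ff gg.
  rewrite kk mm => f g IHf IHg /IHf/existT_mu_rec_inj <- gg.
  congr (existT _ _ (Comp _ _)); apply/funext => i.
  apply: existT_mu_rec_inj; apply: IHg.
  by move/eq_in_map : gg => -> //; rewrite mem_enum.
- move=> k2 f2 g2 [kk ff gg]; move: f g IHf IHg ff gg; rewrite kk.
  move=> f g IHf IHg /IHf/existT_mu_rec_inj <-.
  by move=> /IHg/existT_mu_rec_inj <-.
- move=> k2 f2 [kk ff]; move: f IHf ff; rewrite kk.
  by move=> f IHf /IHf/existT_mu_rec_inj <-.
Qed.

End code.

Lemma mu_rec_code_inj k : injective (@mu_rec_code k).
Proof. by move=> f g /mu_rec_code_inj_dep/existT_mu_rec_inj. Qed.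

(** Three programs fix rational approximations of every precision, hence the whole family, and
    programs are countable. *)
Lemma countable_uniformly_computable (R : realType) k :
  countable (@uniformly_computable R k).
Proof.
pose code_of c (x : k.-tuple nat -> R) :=
  exists a b d : k.+1.-tuple nat -> nat,
   [/\ forall v, computes c.1.1 v (a v), forall v, computes c.1.2 v (b v),
     forall v, computes c.2 v (d v) &
        forall (v : k.-tuple nat) (n : nat),
          let w := [tuple of n :: v] in
          `|x v - ((a w)%:R - (b w)%:R) / (d w).+1%:R| <= 2 ^- n].
have code_inj c x y : code_of c x -> code_of c y -> x = y.
  move=> [a [b [d [ca cb cd xE]]]] [a' [b' [d' [ca' cb' cd' yE]]]].
  apply/funext => v; apply/eqP; rewrite -subr_eq0 -normr_le0.
  apply/ler_addgt0Pl => e e0; rewrite addr0.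
  (* Both values lie within [2 ^- n] of the same rational, hence within twice that of each other. *)
  have [n ne] : exists n, 2 ^- n *+ 2 <= e.
    have [n] := near_infty_natSinv_expn_lt (PosNum (divr_gt0 e0 (ltr0Sn R 1))).
    move=> _ /(_ n (leqnn _)) /=; rewrite div1r => /ltW h; exists n.
    by rewrite mulr2n [leRHS]splitr lerD.
  apply: le_trans ne; have := xE v n; have := yE v n => /=.
  rewrite -(computes_fun (ca _) (ca' _)) -(computes_fun (cb _) (cb' _)).
  rewrite -(computes_fun (cd _) (cd' _)); set q := (_ / _) => yq xq.
  rewrite -(subrKA q) mulr2n; apply: le_trans (ler_normD _ _) _.
  by rewrite lerD // distrC.
have ex x : uniformly_computable x -> exists c, code_of c x.
  move=> [a [b [d [[ca ha] [cb hb] [cd hd] h]]]].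
  by exists (ca, cb, cd), a, b, d.
pose code (c : mu_rec k.+1 * mu_rec k.+1 * mu_rec k.+1) : nat :=
  pickle (mu_rec_code c.1.1, mu_rec_code c.1.2, mu_rec_code c.2).
apply/countable_injP.
exists (fun x => if pselect (uniformly_computable x) is left h
               then code (sval (cid (ex x h))) else 0%N).
move=> x y /set_mem hx /set_mem hy.
case: pselect => // hx'; case: pselect => // hy'.
case: cid => -[[a b] c] hc; case: cid => -[[a' b'] c'] hc' /=.
move=> /(pcan_inj pickleK) /= -[].
move=> /mu_rec_code_inj aa /mu_rec_code_inj bb /mu_rec_code_inj cc.
by subst; exact: code_inj hc hc'.
Qed.

(** * Closure properties of computable functions; c.e. sets *)

Lemma computable_fun_tnth k (i : 'I_k) : computable_fun (fun v => tnth v i).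
Proof. by exists (Proj i). Qed.

Lemma computable_fun_comp k m (f : m.-tuple nat -> nat)
    (g : 'I_m -> k.-tuple nat -> nat) :
  computable_fun f -> (forall i, computable_fun (g i)) ->
  computable_fun (fun v => f [tuple g i v | i < m]).
Proof.
move=> [c cf] /choice[d dg]; exists (Comp c d) => v /=.
by exists [tuple g i v | i < m] => // i; rewrite tnth_mktuple.
Qed.

Lemma computable_fun_rec k (f : k.-tuple nat -> nat) (g : k.+2.-tuple nat -> nat)
    (h : k.+1.-tuple nat -> nat) :
  computable_fun f -> computable_fun g ->
  (forall v : k.-tuple nat, h [tuple of 0%N :: v] = f v) ->
  (forall n (v : k.-tuple nat),
     h [tuple of n.+1 :: v] = g [tuple of n :: h [tuple of n :: v] :: v]) ->
  computable_fun h.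
Proof.
move=> [c cf] [d dg] h0 hS; exists (PrimRec c d) => v /=.
exists (fun n => h [tuple of n :: behead v]); split.
- by rewrite h0.
- by move=> i _; rewrite hS.
- by rewrite [in LHS](tuple_eta v).
Qed.

Lemma computable_fun0 k : computable_fun (fun _ : k.-tuple nat => 0%N).
Proof. by exists (Zero k). Qed.

Lemma computable_fun_op1 k op (f : k.-tuple nat -> nat) :
  computable_fun (fun v : 1.-tuple nat => op (thead v)) -> computable_fun f ->
  computable_fun (fun v => op (f v)).
Proof.
move=> cop cf; have := computable_fun_comp cop (fun=> cf).
by under [X in computable_fun X]eq_fun do rewrite /thead tnth_mktuple.
Qed.

Lemma computable_funS k (f : k.-tuple nat -> nat) :
  computable_fun f -> computable_fun (fun v => (f v).+1).
Proof. by apply: (computable_fun_op1 (op := S)); exists Succ. Qed.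

Definition computable_op2 (op : nat -> nat -> nat) :=
  computable_fun (fun v : 2.-tuple nat => op (tnth v ord0) (tnth v ord_max)).

Lemma computable_fun_op2 k op (f g : k.-tuple nat -> nat) :
  computable_op2 op -> computable_fun f -> computable_fun g ->
  computable_fun (fun v => op (f v) (g v)).
Proof.
move=> cop cf cg; pose h (i : 'I_2) := if i == ord0 then f else g.
have /(computable_fun_comp cop) : forall i, computable_fun (h i).
  by move=> i; rewrite /h; case: ifP.
by under [X in computable_fun X]eq_fun do rewrite !tnth_mktuple /=.
Qed.

Lemma computable_addn : computable_op2 addn.
Proof.
apply: (computable_fun_rec (computable_fun_tnth ord0)
  (computable_funS (computable_fun_tnth (lift ord0 ord0)))) => [v|n v].
  by case/tupleP: v => a v.
by case/tupleP: v => a v.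
Qed.

Lemma computable_muln : computable_op2 muln.
Proof.
apply: (computable_fun_rec (computable_fun0 _) (computable_fun_op2 computable_addn
  (computable_fun_tnth ord_max) (computable_fun_tnth (lift ord0 ord0)))) => [v|n v].
  by [].
by case/tupleP: v => a v; rewrite [LHS]mulSn.
Qed.

Lemma computable_predn k (f : k.-tuple nat -> nat) :
  computable_fun f -> computable_fun (fun v => (f v).-1).
Proof.
apply: (computable_fun_op1 (op := predn)).
exact: (computable_fun_rec (computable_fun0 _) (computable_fun_tnth ord0)).
Qed.

Lemma computable_subn k (f g : k.-tuple nat -> nat) :
  computable_fun f -> computable_fun g -> computable_fun (fun v => f v - g v)%N.
Proof.
(* Recursion runs on the first argument, so the subtrahend is put there. *)
move=> cf cg; apply: (computable_fun_op2 (op := fun m n => n - m)%N) => //.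
apply: (computable_fun_rec (computable_fun_tnth ord0)
  (computable_predn (computable_fun_tnth (lift ord0 ord0)))) => [v|n v].
  by case/tupleP: v => a v; rewrite [LHS]subn0.
by case/tupleP: v => a v; rewrite [LHS]subnS.
Qed.

(** The minimisation uses a test that ignores the search variable: it stops at once if [f v] is 0
    and never otherwise. *)
Lemma ce_set_zeros k (f : k.-tuple nat -> nat) :
  computable_fun f -> ce_set [set v | f v = 0%N].
Proof.
move=> [c cf]; exists (Mu (Comp c (fun i => Proj (lift ord0 i)))).
apply/seteqP; split => v /= [].
  move=> fv; exists 0%N; split => //; exists v => [i|]; last by rewrite -fv.
  by rewrite tnthS.
move=> y [[w wv cw] _]; suff -> : v = w by exact: computes_fun (cf w) cw.
by apply: eq_from_tnth => i; rewrite wv tnthS.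
Qed.

Lemma ce_set_eq k (f g : k.-tuple nat -> nat) :
  computable_fun f -> computable_fun g -> ce_set [set v | f v = g v].
Proof.
move=> cf cg; rewrite [X in ce_set X](_ : _ =
    [set v | ((f v - g v) + (g v - f v) = 0)%N]).
  by apply: ce_set_zeros; apply: (computable_fun_op2 computable_addn);
    exact: computable_subn.
apply/seteqP; split => v /= h; first by rewrite h subnn.
by apply/eqP; rewrite eqn_leq -!subn_eq0 -addn_eq0 h.
Qed.

(** * Second countable T0 spaces as computable topological spaces *)

Fixpoint prime_seq n : nat :=
  if n is m.+1 then s2val (prime_above (prime_seq m)) else 2.

Lemma prime_seqP n : prime (prime_seq n).
Proof. by case: n => //= n; case: prime_above. Qed.

Lemma prime_seq_ltn m n : (m < n)%N -> (prime_seq m < prime_seq n)%N.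
Proof.
elim: n => // n IHn; rewrite ltnS leq_eqVlt /=.
by case: prime_above => p /= np _ /orP[/eqP -> //|/IHn /ltn_trans]; apply.
Qed.

(** Hence only finitely many [prime_seq n] divide a given positive number, which makes the basic
    sets below finite intersections. *)
Lemma prime_seq_gt n : (n < prime_seq n)%N.
Proof. by elim: n => // n /leq_ltn_trans; apply; exact: prime_seq_ltn. Qed.

(* The number i stands for the finite set of the n such that the n-th prime of
   the sequence divides i.+1; a product of codes i.+1 then stands for a union. *)
Lemma second_countable_computable (T : topologicalType) (U : nat -> set T) :
  kolmogorov_space T -> basis (range U) ->
  exists beta nu, computable_topological_space (T := T) beta nu.
Proof.
move=> T0 [oU bU].
pose nu i := \bigcap_(n in [set n | prime_seq n %| i.+1]%N) U n.
have nuM i j : nu i `&` nu j = nu (i.+1 * j.+1).-1.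
  rewrite /nu prednK ?muln_gt0 // -bigcap_setU; congr (\bigcap_(_ in _) _).
  apply/seteqP; split => n /=; rewrite Euclid_dvdM ?prime_seqP //.
    by case=> ->; rewrite ?orbT.
  by move/orP.
(* The prime itself codes the singleton of [n], so each [U n] belongs to the new base. *)
have nuU n : nu (prime_seq n).-1 = U n.
  rewrite /nu prednK ?prime_gt0 ?prime_seqP //.
  apply/seteqP; split=> x; first by apply; exact: dvdnn.
  move=> Ux m /=; rewrite dvdn_prime2 ?prime_seqP // => /eqP mn.
  suff -> : m = n by [].
  by case: (ltngtP m n) => // /prime_seq_ltn; rewrite mn ltnn.
exists (range nu), nu; split => //.
- split.
    move=> _ [i _ <-]; rewrite -closedC setC_bigcap; apply: closed_bigcup.
      apply: sub_finite_set (finite_II i.+1) => n /= /dvdn_leq.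
      by move=> /(_ isT); exact: leq_trans (prime_seq_gt n).
    by move=> n _; rewrite closedC; apply: oU; exists n.
  move=> x A /bU [B [[n _ <-] Ux] UA]; exists (U n) => //; split => //.
  by exists (prime_seq n).-1.
(* For given [i] and [j] a single index is enumerated, the code of the intersection. *)
- exists [set v | (tnth v ord_max).+1 =
    ((tnth v ord0).+1 * (tnth v (lift ord0 ord0)).+1)%N].
    apply: ce_set_eq; last apply: (computable_fun_op2 computable_muln);
      by apply/computable_funS/computable_fun_tnth.
  move=> i j; rewrite nuM; apply/seteqP; split => [x nux|x [k kij]].
    by exists (i.+1 * j.+1).-1.
  have kE : k.+1 = (i.+1 * j.+1)%N by exact: kij.
  by rewrite -kE.
Qed.

(** * Countable compact metric spaces *)

(* Iterating the two copies gives a Cantor scheme of nested compact sets; a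
   branch that avoids the n-th point at step n has an empty intersection. *)
Lemma countable_compact_two_copies (T : topologicalType) (g : bool -> T -> T)
    (x0 : T) :
  hausdorff_space T -> compact [set: T] -> countable [set: T] ->
  (forall b, continuous (g b)) -> (forall b, injective (g b)) ->
  ~ (forall x y, g false x <> g true y).
Proof.
move=> T2 Tco /countable_injP[e einj] gc gi g01.
have {}einj : injective e by move=> x y; apply: einj; exact: in_setT.
(* The two images are disjoint, so for injective [h] at most one of the two copies inside its range
   contains the point numbered [n]; [b] selects one that misses it. *)
have /choice[B avoid] : forall hn : (T -> T) * nat, exists b,
    injective hn.1 -> forall x, e (hn.1 (g b x)) <> hn.2.
  move=> [h n] /=; have [hx|/forallNP hx] :=
    pselect (exists x, e (h (g false x)) = n).
    exists true => hi y; case: hx => x <- /einj/hi/esym; exact: g01.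
  by exists false.
pose h := fix h n := if n is m.+1 then h m \o g (B (h m, m)) else id.
have hc n : continuous (h n).
  elim: n => [|n IHn] x; first exact: cvg_id.
  by apply: continuous_comp; [exact: gc|exact: IHn].
have hi n : injective (h n).
  elim: n => [|n IHn]; first exact: inj_id.
  by apply: inj_comp => //; exact: gi.
have hle m n x : (m <= n)%N -> range (h m) (h n x).
  move=> /subnK <-; elim: (n - m)%N x => [|k IHk] x; first by exists x.
  by rewrite addSn; exact: IHk.
have hcl n : closed (range (h n)).
  apply: compact_closed => //; apply: continuous_compact => //.
  exact: continuous_subspaceT.
(* The ranges of the [h n] are nested and closed, so a cluster point of this sequence lies in all of
   them. *)
have [|p [_ clp]] := Tco ((fun n => h n x0) @ \oo) _; first exact: filterT.
have [x _ hx] : range (h (e p).+1) p.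
  apply: hcl => A pA; have [|y [[z _ <-] Az]] := clp (range (h (e p).+1)) A _ pA.
    by exists (e p).+1 => // n; exact: hle.
  by exists (h (e p).+1 z); split => //; exists z.
by apply: (avoid (h (e p), e p) (hi _) x); rewrite /= -[in RHS]hx.
Qed.

Lemma countable_enum (T : Type) (x0 : T) :
  countable [set: T] -> exists s : nat -> T, forall x, exists n, s n = x.
Proof.
move=> /countable_injP[f fi].
have /choice[s sP] : forall n, exists x, forall y, f y = n -> y = x.
  move=> n; have [[x fx]|/forallNP h] := pselect (exists x, f x = n).
    by exists x => y fy; apply: fi; rewrite ?in_setT // fx.
  by exists x0 => y /h.
by exists s => x; exists (f x); apply/esym/sP.
Qed.

Section metric.
Context {R : realType}.

Lemma countable_metric_basis (T : metricType R) (x0 : T) : countable [set: T] ->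
  exists U : nat -> set T, basis (range U).
Proof.
move=> /(countable_enum x0)[s sP].
exists (fun k => if unpickle k is Some (i, j)
                 then (ball (s i) (j.+1%:R^-1 : R))° else set0).
split=> [_ [k _ <-]|x A /nbhs_ballP[e /= e0 eA]].
  by case: unpickle => [[i j]|]; [exact: open_interior|exact: open0].
have [i sx] := sP x;
have [j _ /(_ j (leqnn j)) /= je] := near_infty_natSinv_lt (PosNum e0).
exists (ball x (j.+1%:R^-1 : R))°.
  split; last by apply: nbhsx_ballx; rewrite invr_gt0.
  by exists (pickle (i, j)) => //; rewrite pickleK sx.
apply: subset_trans (@interior_subset _ _) _; apply: subset_trans eA.
exact: le_ball (ltW je).
Qed.

Lemma compact_metric_complete (T : metricType R) :
  compact [set: T] -> compatible_complete_metric (@mdist R T).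
Proof.
move=> Tco; split.
- exact: mdistxx.
- exact: mdist_positivity.
- exact: metric_sym.
- by move=> y x z; exact: metric_triangle.
- move=> x; rewrite -nbhs_ballE; congr (nbhs_ball_ _ x).
  by apply/funext => y; apply/funext => e; rewrite ballEmdist.
move=> u uC; have [|p [_ clp]] := Tco (u @ \oo) _; first exact: filterT.
exists p; apply/cvg_ballP => e e0; rewrite ballEmdist.
have e20 : 0 < e / 2 by rewrite divr_gt0.
have [N uN] := uC _ e20.
have [|y [[m /= Nm <-] pm]] := clp [set u n | n in [set n | (N <= n)%N]]
  _ _ (nbhsx_ballx p _ e20).
  by exists N => // n /= Nn; exists n.
exists N => // n /= Nn; rewrite (splitr e).
apply: le_lt_trans (metric_triangle _ (u m) _) _.
by move: pm; rewrite ballEmdist => pm; apply: ltrD => //; exact: uN.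
Qed.

(** A point [x] is sent to a point of [K] whose distances to the [b n] are those of [x] to the
    [a n]. Compactness provides such a point; density of [a] makes the map continuous and
    injective. *)
Lemma isometry_extension (M K : metricType R) (a : nat -> M) (b : nat -> K) :
  dense (range a) -> compact [set: K] ->
  (forall i j, mdist (b i) (b j) = mdist (a i) (a j)) ->
  exists2 f : M -> K, continuous f & injective f.
Proof.
move=> ad Kco ab.
have near_a x (e : R) : 0 < e -> exists n, mdist x (a n) < e.
  move=> e0; have [|y [/interior_subset xy [n _ ny]]] :=
    ad (ball x e)° _ (@open_interior _ _).
    by exists x; exact: nbhsx_ballx.
  by exists n; move: xy; rewrite ballEmdist -ny.
have /choice[f fP] : forall x, exists y, forall n, mdist y (b n) = mdist x (a n).
  move=> x.
  have /choice[k kP] : forall n, exists k, mdist x (a k) < n.+1%:R^-1.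
    by move=> n; apply: near_a; rewrite invr_gt0.
  have [|y [_ cly]] := Kco (b \o k @ \oo) _; first exact: filterT.
  exists y => m; apply/eqP; rewrite -subr_eq0 -normr_le0.
  apply/ler_addgt0Pl => e e0; rewrite addr0.
  have e20 : 0 < e / 2 by rewrite divr_gt0.
  have [N _ eN] := near_infty_natSinv_lt (PosNum e20).
  have [|z [[n /= Nn <-]]] := cly [set b (k n) | n in [set n | (N <= n)%N]]
    _ _ (nbhsx_ballx y _ e20).
    by exists N => // n /= Nn; exists n.
  rewrite ballEmdist /= => yn; have := eN _ Nn; move: (kP n) => /=.
  move=> /lt_trans/[apply] xn.
  (* The four triangle inequalities bound the difference by [mdist y (b (k n)) + mdist x (a (k n))],
     each term being below [e / 2]. *)
  have := metric_triangle y (b (k n)) (b m).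
  have := metric_triangle (b (k n)) y (b m).
  have := metric_triangle x (a (k n)) (a m).
  have := metric_triangle (a (k n)) x (a m).
  rewrite (metric_sym (b (k n)) y) (metric_sym (a (k n)) x) ab ler_norml.
  by move=> *; apply/andP; split; lra.
exists f => [x|x y fxy].
  apply/cvg_ballP => e e0; have e30 : 0 < e / 3 by rewrite divr_gt0.
  have [n xn] := near_a x _ e30.
  apply/nbhs_ballP; exists (e / 3) => //= y.
  rewrite !ballEmdist /= => xy; apply: le_lt_trans (metric_triangle _ (b n) _) _.
  rewrite (metric_sym _ (f y)) !fP; have := metric_triangle y x (a n).
  by rewrite (metric_sym y x); lra.
apply: mdist_positivity; apply/eqP; rewrite -normr_le0.
apply/ler_addgt0Pl => e e0; rewrite addr0 ger0_norm ?mdist_ge0 //.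
have e20 : 0 < e / 2 by rewrite divr_gt0.
have [n xn] := near_a x _ e20.
apply: le_trans (metric_triangle _ (a n) _) _.
by rewrite (metric_sym _ y) -!fP -fxy fP; lra.
Qed.

End metric.

(** * The one-point compactification of a disjoint union *)

(* None is the point at infinity. *)
Definition bouquet (R : realType) (X : nat -> metricType R) : Type :=
  option {n & X n}.

HB.instance Definition _ (R : realType) (X : nat -> metricType R) :=
  Choice.on (bouquet X).

Section bouquet.
Context {R : realType} (X : nat -> metricType R).
Implicit Types p q r : bouquet X.

Definition petal n (x : X n) : bouquet X := Some (existT (fun i => X i) n x).

(* The n-th summand has diameter at most 1 / (n + 1) and lies at distance
   1 / (n + 1) from None. *)
Definition bouquet_height p : R := if p is Some u then (tag u).+1%:R^-1 else 0.

(** Distinct summands are as far apart as the larger height. Cutting the metric of a summand off at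
    its height keeps the triangle inequality for detours through other summands. *)
Definition bouquet_dist p q : R :=
  match p, q with
  | Some u, Some v =>
      if tag u == tag v
      then Num.min (bouquet_height p) (mdist (tagged u) (tagged_as u v))
      else Num.max (bouquet_height p) (bouquet_height q)
  | _, _ => Num.max (bouquet_height p) (bouquet_height q)
  end.

Local Notation ht := bouquet_height.
Local Notation d := bouquet_dist.
Local Notation same p q := (omap tag p == omap tag q :> option nat).

Lemma bouquet_height_ge0 p : 0 <= ht p.
Proof. by case: p => //= u; rewrite invr_ge0. Qed.

Lemma bouquet_height_same p q : same p q -> ht p = ht q.
Proof. by case: p q => [u|] [v|] //= /eqP[->]. Qed.

Lemma bouquet_dist_petal n (x y : X n) :
  d (petal x) (petal y) = Num.min n.+1%:R^-1 (mdist x y).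
Proof. by rewrite /d /petal /= eqxx tagged_asE. Qed.

Lemma bouquet_dist_diff p q : ~~ same p q -> d p q = Num.max (ht p) (ht q).
Proof.
by case: p q => [u|] [v|] //=; case: ifPn => // /eqP uv /eqP[]; rewrite uv.
Qed.

(** This case analysis on [same p q] yields two points of one summand with no transport along an
    equality of tags. *)
Variant same_spec : bouquet X -> bouquet X -> bool -> Prop :=
| SameNone : same_spec None None true
| SamePetal n (x y : X n) : same_spec (petal x) (petal y) true
| SameNot p q : ~~ same p q -> same_spec p q false.

Lemma sameP p q : same_spec p q (same p q).
Proof.
case: eqP => [|/eqP]; last by constructor.
case: p q => [[m x]|] [[n y]|] //= => [[mn]|_]; last by constructor.
by subst m; exact: SamePetal.
Qed.

Lemma bouquet_distxx p : d p p = 0.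
Proof.
case: p => [[n x]|]; last by rewrite /d maxxx.
by rewrite bouquet_dist_petal mdistxx min_r // invr_ge0.
Qed.

Lemma bouquet_dist_sym p q : d p q = d q p.
Proof.
case: (sameP p q) => [//|n x y|p' q' pq].
  by rewrite !bouquet_dist_petal metric_sym.
by rewrite !bouquet_dist_diff 1?maxC // eq_sym.
Qed.

Lemma bouquet_dist_ge0 p q : 0 <= d p q.
Proof.
case: (sameP p q) => [|n x y|p' q' pq].
- by rewrite bouquet_distxx.
- by rewrite bouquet_dist_petal le_min mdist_ge0 invr_ge0 ler0n.
- by rewrite bouquet_dist_diff // le_max bouquet_height_ge0.
Qed.

Lemma bouquet_dist_le_height p q : d p q <= Num.max (ht p) (ht q).
Proof.
case: (sameP p q) => [//|n x y|p' q' pq].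
  by rewrite bouquet_dist_petal le_max ge_min lexx.
by rewrite bouquet_dist_diff.
Qed.

Lemma bouquet_dist_positivity p q : d p q = 0 -> p = q.
Proof.
case: (sameP p q) => [//|n x y|p' q' pq].
  rewrite bouquet_dist_petal; case: leP => _.
    by move/eqP; rewrite invr_eq0 pnatr_eq0.
  by move/mdist_positivity => ->.
rewrite bouquet_dist_diff // => h.
have {h} : (ht p' <= 0) && (ht q' <= 0) by rewrite -ge_max h.
by case: p' q' pq => [u|] [v|] //= _; rewrite !invr_le0 !lern0 ?andbF.
Qed.

(** If [q] is in another summand than [p] or [r], the right-hand side is at least the larger height
    of [p] and [r], which bounds [d p r]. Otherwise all three are in one summand or at infinity. *)
Lemma bouquet_dist_triangle q p r : d p r <= d p q + d q r.
Proof.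
have pq0 := bouquet_dist_ge0 p q; have qr0 := bouquet_dist_ge0 q r.
have [pq|pq] := boolP (same p q).
  have [qr|qr] := boolP (same q r).
    move: pq qr {pq0 qr0}; case: p q r => [[m x]|] [[n y]|] [[k z]|] //=.
      move=> /eqP[mn] /eqP[nk]; subst m k.
      change (d (petal x) (petal z) <=
        d (petal x) (petal y) + d (petal y) (petal z)).
      rewrite !bouquet_dist_petal.
      have := metric_triangle x y z; have : 0 <= n.+1%:R^-1 :> R by [].
      have := mdist_ge0 x y; have := mdist_ge0 y z.
      move: (mdist x y) (mdist y z) (mdist x z) n.+1%:R^-1 => a b c w *.
      by case: (leP w a) => ?; case: (leP w b) => ?; case: (leP w c) => ?; lra.
    by rewrite /bouquet_dist /= maxxx addr0.
  rewrite (bouquet_dist_diff qr) -(bouquet_height_same pq).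
  by apply: le_trans (bouquet_dist_le_height p r) _; rewrite lerDr.
have [qr|qr] := boolP (same q r).
  rewrite (bouquet_dist_diff pq) (bouquet_height_same qr).
  by apply: le_trans (bouquet_dist_le_height p r) _; rewrite lerDl.
apply: le_trans (bouquet_dist_le_height p r) _.
rewrite !bouquet_dist_diff //.
have := bouquet_height_ge0 p; have := bouquet_height_ge0 q.
have := bouquet_height_ge0 r.
move: (ht p) (ht q) (ht r) => a b c *.
by case: (leP a b) => ?; case: (leP b c) => ?; case: (leP a c) => ?; lra.
Qed.

HB.instance Definition _ := isMetric.Build R (bouquet X) bouquet_distxx
  bouquet_dist_positivity bouquet_dist_sym bouquet_dist_triangle.

Lemma petal_continuous n : continuous (@petal n : X n -> bouquet X).
Proof.
move=> x; apply/cvg_ballP => e e0; apply/nbhs_ballP; exists e => //= y.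
rewrite !ballEmdist /= => xy.
by rewrite [mdist _ _]bouquet_dist_petal gt_min xy orbT.
Qed.

Lemma petal_inj n : injective (@petal n).
Proof. by move=> x y [] /eqP; rewrite eq_Tagged => /eqP. Qed.

(** A filter that does not cluster at [None] contains a set missing a ball about [None]. All but
    finitely many petals lie in that ball, so the set sits in a finite union of compact petals. *)
Lemma bouquet_compact :
  (forall n, compact [set: X n]) -> compact [set: bouquet X].
Proof.
move=> Xco F FF _.
have [cl|/existsNP[A /existsNP[B /not_implyP[FA /not_implyP[nB AB]]]]] :=
  pselect (cluster F (None : bouquet X)); first by exists None.
move: nB => /nbhs_ballP[e /= e0 eB].
have [N _ Ne] := near_infty_natSinv_lt (PosNum e0).
have [||p [_ clp]] := @bigsetU_compact _ nat (fun n => range (@petal n))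
  (iota 0 N) xpredT _ F FF _.
- move=> n _; apply: continuous_compact => //.
  exact/continuous_subspaceT/petal_continuous.
- apply: filterS FA => p Ap; case: p Ap => [[n x]|] Ap; last first.
    exfalso; apply: AB; exists None; split => //.
    exact/eB/ballxx.
  rewrite -bigcup_seq /=; exists n; last by exists x.
  rewrite /= mem_iota add0n /= ltnNge; apply/negP => Nn.
  apply: AB; exists (petal x); split=> //; apply: eB.
  rewrite ballEmdist /=.
  by rewrite [mdist _ _]bouquet_dist_diff //= max_r ?invr_ge0 //; exact: Ne.
- by exists p.
Qed.

Lemma bouquet_countable :
  (forall n, countable [set: X n]) -> countable [set: bouquet X].
Proof.
move=> Xc.
have finj n : exists f : X n -> nat, injective f.
  have /countable_injP[f fi] := Xc n; exists f => x y.
  by apply: fi; exact: in_setT.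
pose f n := sval (cid (finj n));
have fi n : injective (f n) := svalP (cid (finj n)).
apply/countable_injP.
exists (fun p : bouquet X => pickle (omap (fun u => (tag u, f _ (tagged u))) p)).
move=> [[m x]|] [[n y]|] _ _ /(pcan_inj pickleK) //= [mn].
by subst m => /fi ->.
Qed.

End bouquet.

(** * Distance matrices *)

(** An alias that keeps only the choice structure of [M], so that [d] can supply the topology;
    [nbhs_metrized] identifies it with the original one. *)
Definition metrized (R : realType) (M : topologicalType) (d : M -> M -> R)
  (dP : compatible_complete_metric d) : Type := M.

HB.instance Definition _ (R : realType) (M : topologicalType) (d : M -> M -> R)
  (dP : compatible_complete_metric d) := Choice.on (metrized dP).

HB.instance Definition _ (R : realType) (M : topologicalType) (d : M -> M -> R)
  (dP : compatible_complete_metric d) := isMetric.Build R (metrized dP)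
  (metricxx dP) (metric_positivity dP) (metric_symmetry dP) (metric_triangular dP).

Lemma nbhs_metrized (R : realType) (M : topologicalType) (d : M -> M -> R)
    (dP : compatible_complete_metric d) (x : M) :
  nbhs (x : metrized dP) = nbhs x.
Proof.
by rewrite (metric_compatible dP) -nbhs_ballE; congr (nbhs_ball_ _ x).
Qed.

(** Filler for the numbers that code no realised distance matrix. *)
Definition singleton_metric (R : realType) : Type := unit.

HB.instance Definition _ (R : realType) := Choice.on (singleton_metric R).

Section singleton_metric.
Variable R : realType.
Let d (x y : singleton_metric R) : R := 0.

Let dxx x : d x x = 0. Proof. by []. Qed.

Let d_positivity x y : d x y = 0 -> x = y. Proof. by case: x y => -[]. Qed.

Let d_sym x y : d x y = d y x. Proof. by []. Qed.

Let d_triangle y x z : d x z <= d x y + d y z. Proof. by rewrite addr0. Qed.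

HB.instance Definition _ := isMetric.Build R (singleton_metric R)
  dxx d_positivity d_sym d_triangle.

Lemma singleton_metric_compact : compact [set: singleton_metric R].
Proof.
rewrite (_ : [set: _] = [set (tt : singleton_metric R)]).
  exact: compact_set1.
by apply/seteqP; split => -[].
Qed.

Lemma singleton_metric_countable : countable [set: singleton_metric R].
Proof. by apply/countable_injP; exists (fun=> 0%N) => -[] []. Qed.

End singleton_metric.

Definition distance_matrix (R : realType) (M : metricType R) (a : nat -> M)
  (v : 2.-tuple nat) : R := mdist (a (tnth v ord0)) (a (tnth v ord_max)).

(** One space is chosen per code [n]. Coding is injective on computable matrices, so the space
    chosen for the code of a matrix realises that very matrix. *)
Lemma countable_computably_metrized (R : realType) :
  exists K : nat -> metricType R,
    (forall n, compact [set: K n] /\ countable [set: K n]) /\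
    forall (M : metricType R) (a : nat -> M),
      compact [set: M] -> countable [set: M] ->
      uniformly_computable (distance_matrix a) ->
      exists n (b : nat -> K n), distance_matrix b = distance_matrix a.
Proof.
have /countable_injP[e einj] := countable_uniformly_computable R 2.
pose realized n (M : metricType R) (a : nat -> M) :=
  [/\ compact [set: M], countable [set: M],
    uniformly_computable (distance_matrix a) & e (distance_matrix a) = n].
have /choice[K KP] : forall n, exists K : metricType R,
    (compact [set: K] /\ countable [set: K]) /\
    ((exists (M : metricType R) (a : nat -> M), realized n M a) ->
     exists b : nat -> K, realized n K b).
  move=> n; have [[M [a Ma]]|no] :=
      pselect (exists (M : metricType R) (a : nat -> M), realized n M a).
    exists M; split; first by case: Ma.
    by move=> _; exists a.
  exists (singleton_metric R); split => //; split.
    exact: singleton_metric_compact.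
  exact: singleton_metric_countable.
exists K; split=> [n|M a Mco Mcnt auc]; first exact: (KP n).1.
have [|b [_ _ buc eb]] := (KP (e (distance_matrix a))).2; first by exists M, a.
by exists (e (distance_matrix a)), b; apply: einj eb; exact/mem_set.
Qed.

Theorem theorem1p1 (R : realType) :
  exists (S : topologicalType) (beta : set (set S)) (nu : nat -> set S),
    [/\ computable_topological_space beta nu,
        compact [set: S],
        polish R S &
        forall M : topologicalType,
          polish R M -> computably_metrized R M -> ~ homeomorphic S M].
Proof.
have [K [KP Kuniv]] := countable_computably_metrized R.
(* Halving the index makes each [K n] occur twice, at [n.*2] and at its successor. *)
pose X n := K n./2; pose S : metricType R := bouquet X; pose x0 : S := None.
have Sco : compact [set: S] by apply: bouquet_compact => n; exact: (KP _).1.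
have Scnt : countable [set: S] by apply: bouquet_countable => n; exact: (KP _).2.
have S2 : hausdorff_space S := @metric_hausdorff _ _.
have [U Ub] := countable_metric_basis x0 Scnt.
have [beta [nu Snu]] := second_countable_computable
  (accessible_kolmogorov (hausdorff_accessible S2)) Ub.
exists S, beta, nu; split => //.
  split; first by exists (@mdist R S); exact: compact_metric_complete.
  have [s sP] := countable_enum x0 Scnt.
  exists s => O [x Ox] _; have [n sn] := sP x.
  by exists x; split => //; exists n.
move=> M _ [d [a [dP ad auc]]] [f [g [fK gK fc gc]]].
pose M' : metricType R := metrized dP.
have fc' : continuous (f : S -> M').
  by move=> x A; rewrite nbhs_metrized => /fc.
have M'co : compact [set: M'].
  rewrite (_ : [set: M'] = range (f : S -> M')).
    by apply: continuous_compact => //; exact: continuous_subspaceT.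
  by apply/seteqP; split => // y _; exists (g y).
have M'cnt : countable [set: M'].
  have /countable_injP[i ii] := Scnt.
  apply/countable_injP; exists (i \o g) => y z _ _ /ii.
  by move=> /(_ (in_setT _) (in_setT _)) /(can_inj gK).
have a'd : dense (range (a : nat -> M')).
  move=> O O0; rewrite openE => oO; apply: ad => //; rewrite openE => x Ox.
  by have := oO x Ox; rewrite /interior nbhs_metrized.
have [n [b ab]] := Kuniv M' a M'co M'cnt auc.
have [phi phic phii] : exists2 phi : M' -> K n, continuous phi & injective phi.
  apply: (isometry_extension (b := b) a'd (KP n).1) => i j.
  by have := congr1 (fun D => D [tuple i; j]) ab.
(* Copy [c] of [M'] goes into the summand [c + n.*2], so the parity of the tag tells the copies
   apart. *)
have /choice[h hP] (c : bool) : exists h : M' -> S,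
    [/\ continuous h, injective h & forall y, omap tag (h y) = Some (c + n.*2)%N].
  have [psi psic psii] : exists2 psi : M' -> X (c + n.*2)%N,
      continuous psi & injective psi.
    by rewrite /X half_bit_double; exists phi.
  exists (fun y => petal (psi y)); split => // [y|].
    by apply: continuous_comp; [exact: psic|exact: petal_continuous].
  by apply: inj_comp psii; exact: petal_inj.
(* Composed with [f], the two embeddings of [M'] become self-embeddings of [S] with disjoint
   images. *)
apply: (@countable_compact_two_copies S (fun c => h c \o f) x0) => //.
- move=> c x; have [hc _ _] := hP c.
  by apply: continuous_comp; [exact: fc'|exact: hc].
- by move=> c; have [_ hi _] := hP c; apply: inj_comp hi (can_inj fK).
- move=> x y; have [_ _ hf] := hP false; have [_ _ ht] := hP true => xy.
  have := ht (f y); rewrite -[h true _]xy [omap _ _]hf => -[] /(congr1 odd).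
  by rewrite /= !odd_double.
Qed.
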